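(* Let $x_{i+1}=g(x_i)$, $g:\mathbb{R}^n\to\mathbb{R}^n$, be a $\Gamma$-equivariant dynamical system, with $\Gamma$ a finite group acting on $\mathbb{R}^n$ by maps $\gamma_\rho$, and let $\mathcal{K}$ be its Koopman operator acting on a complex vector space $\mathcal{F}$ of functions $\mathbb{R}^n\to\mathbb{C}$ that is invariant under $\mathcal{K}$ and under the action of $\Gamma$. Let $R_p$ be a $d_p$-dimensional unitary irreducible matrix representation of $\Gamma$, with operators $\mathcal{P}^p_{mn}$ and subspaces $\mathcal{F}_{p,m}$, $1\le m,n\le d_p$, as defined in the context. Then: (1) $\mathcal{K}(\mathcal{F}_{p,m})\subset\mathcal{F}_{p,m}$ for every $m$; in particular $\mathcal{K}\mathcal{P}^p_{mn}\circ f\in\mathcal{F}_{p,m}$ for all $f\in\mathcal{F}$ and all $m,n$. (2) For all $f\in\mathcal{F}$ and all $k,m,n\in\{1,\dots,d_p\}$, if $\mathcal{K}\mathcal{P}^p_{mn}\circ f=h$, then $\mathcal{K}\mathcal{P}^p_{kn}\circ f=\mathcal{P}^p_{km}\circ h$. Hence the $d_p$ blocks of $\mathcal{K}$ on $\mathcal{F}_{p,1},\dots,\mathcal{F}_{p,d_p}$ are identical, in the sense that for all $k,m$ the operator $\mathcal{P}^p_{km}$ restricts to a linear isomorphism $\mathcal{F}_{p,m}\to\mathcal{F}_{p,k}$ that intertwines the restrictions of $\mathcal{K}$ to $\mathcal{F}_{p,m}$ and $\mathcal{F}_{p,k}$.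
   Context: The set of actions $\{\gamma_\rho:\gamma\in\Gamma\}$ is a group isomorphic to $\Gamma$, and $\Gamma$-equivariance means $g(\gamma_\rho x)=\gamma_\rho g(x)$ for all $x\in\mathbb{R}^n$, $\gamma\in\Gamma$. The Koopman operator is $(\mathcal{K}f)(x)=f(g(x))$. The group acts on functions by $(\gamma_\rho\circ f)(x)=f(\gamma_\rho^{-1}x)$. The projection operators are $$\mathcal{P}^p_{mn}\circ f=\frac{d_p}{|\Gamma|}\sum_{\gamma\in\Gamma}\overline{[R_p(\gamma)]_{mn}}\;\gamma_\rho\circ f,\qquad f\in\mathcal{F},$$ where $[R_p(\gamma)]_{mn}$ is the entry in row $m$ and column $n$. Set $\mathcal{F}_{p,m}=\{\mathcal{P}^p_{mn}\circ f: f\in\mathcal{F},\ n=1,\dots,d_p\}$; the isotypic component of $\mathcal{F}$ for $R_p$ is $\mathcal{F}_p=\mathcal{F}_{p,1}\oplus\dots\oplus\mathcal{F}_{p,d_p}$. *)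

(* Defs.v *)
From HB Require Import structures.
From mathcomp Require Import all_boot all_order all_algebra.
From mathcomp Require Import all_fingroup all_character.
From mathcomp Require Import complex.
From mathcomp Require Import boolp classical_sets functions reals.

Set Implicit Arguments.
Unset Strict Implicit.
Unset Printing Implicit Defensive.

Import Order.TTheory GRing.Theory Num.Theory.

Local Open Scope classical_set_scope.
Local Open Scope ring_scope.
Local Open Scope complex_scope.

Section Defs.
Variables (R : realType) (n : nat) (gT : finGroupType).
Local Notation X := 'cV[R]_n.
Local Notation V := (X -> R[i]).

(* MathComp's {action aT &-> rT} is a right action; here
   (a * b)_rho = a_rho \o b_rho. *)
Definition left_action (rho : gT -> X -> X) : Prop :=
  (forall x, rho 1%g x = x) /\
  (forall a b x, rho (a * b)%g x = rho a (rho b x)).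

Definition equivariant (rho : gT -> X -> X) (g : X -> X) : Prop :=
  forall a x, g (rho a x) = rho a (g x).

Definition koopman (g : X -> X) (f : V) : V := f \o g.

(* For a left action, rho a^-1 is the inverse map of rho a. *)
Definition fun_act (rho : gT -> X -> X) (a : gT) (f : V) : V :=
  fun x => f (rho a^-1%g x).

(* Complex linear subspace, for a set rather than a boolean predicate as in
   GRing.submod_closed. *)
Definition subspace (F : set V) : Prop :=
  F 0 /\ (forall (c : R[i]) u v, F u -> F v -> F (c *: u + v)).

Definition proj_op d (rho : gT -> X -> X)
    (rp : mx_representation R[i] [set: gT]%SET d) (k l : 'I_d) (f : V) : V :=
  (d%:R / #|gT|%:R) *: \sum_(a : gT) Num.conj (rp a k l) *: fun_act rho a f.

Definition row_component d (rho : gT -> X -> X)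
    (rp : mx_representation R[i] [set: gT]%SET d) (F : set V) (m : 'I_d) : set V :=
  [set h | exists f l, F f /\ h = proj_op rho rp m l f].

(* T maps U onto W bijectively and is linear on the subspace U. *)
Definition linear_iso_on (U W : set V) (T : V -> V) : Prop :=
  [/\ subspace U, subspace W,
      forall (c : R[i]) u v, U u -> U v -> T (c *: u + v) = c *: T u + T v
    & set_bij U W T].

End Defs.

(* MathComp representations act on row vectors, by v |-> v *m rp a; a matrix
   representation is irreducible for rows iff it is for columns (pass to
   annihilators), so mx_irreducible is the usual notion. *)
Definition unitary_irrep (R : realType) (gT : finGroupType) d
    (rp : mx_representation R[i] [set: gT]%SET d) : Prop :=
  (forall a, rp a \is unitarymx) /\ mx_irreducible rp.

(* Main.v *)
Require Import Defs.
From HB Require Import structures.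
From mathcomp Require Import all_boot all_order all_algebra.
From mathcomp Require Import all_fingroup all_character.
From mathcomp Require Import complex.
From mathcomp Require Import boolp classical_sets functions reals.

Set Implicit Arguments.
Unset Strict Implicit.
Unset Printing Implicit Defensive.

Import Order.TTheory GRing.Theory Num.Theory.

Local Open Scope classical_set_scope.
Local Open Scope ring_scope.
Local Open Scope complex_scope.

(* Schur's orthogonality relations for the entries of rp give the product rule
   P_mn P_kl = [n = k] P_ml.  Hence the m-th row component is P_mm(F), and
   P_km, P_mk are mutually inverse between the m-th and k-th row components.
   Equivariance of g makes the Koopman operator commute with every P_mn. *)

(** Averaging the matrix unit [delta_mx m j] over conjugation by [G] gives a matrix [S] that
    commutes with [rG]. By Schur's lemma [S] is scalar, and its trace determines the scalar. The sum
    in question is the entry [S n k]. *)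
Lemma mx_irr_coef_orthogonality (C : closedFieldType) (gT : finGroupType)
    (G : {group gT}) d (rG : mx_representation C G d) (m n j k : 'I_d) :
  mx_irreducible rG ->
  d%:R * (\sum_(a in G) rG a^-1%g n m * rG a j k) =
    (#|G| * ((m == j) && (n == k)))%:R.
Proof.
move=> irr.
pose S : 'M_d := \sum_(a in G) rG a^-1%g *m delta_mx m j *m rG a.
have SE : S n k = \sum_(a in G) rG a^-1%g n m * rG a j k.
  rewrite summxE; apply: eq_bigr => a _.
  rewrite -mulmxA mxE (bigD1 m) //= big1 ?addr0 => [|i im].
    rewrite mxE (bigD1 j) //= big1 ?addr0 => [|i ij]; first by rewrite mxE !eqxx mul1r.
    by rewrite mxE (negPf ij) andbF mul0r.
  by rewrite mxE big1 ?mulr0 // => l _; rewrite mxE (negPf im) mul0r.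
have Scent : centgmx rG S.
  apply/centgmxP => c Gc.
  rewrite /S mulmx_suml mulmx_sumr.
  (* Right translation of [a] by [c]: the new factor [rG c^-1] cancels the [rG c] standing on the
     left. *)
  rewrite [RHS](reindex_acts 'R%act _ Gc) ?astabsR //=.
  apply: eq_bigr => a Ga.
  rewrite invMg !repr_mxM ?groupV // !mulmxA.
  by rewrite (repr_mxV _ Gc) mulmxV ?mul1mx // repr_mx_unit.
have /is_scalar_mxP [c Sc] :=
  mx_abs_irr_cent_scalar (group_closure_closed_field irr) Scent.
have trS : \tr S = (#|G| * (m == j))%:R.
  rewrite raddf_sum /= (eq_bigr (fun=> (m == j)%:R)) => [|a Ga].
    by rewrite sumr_const natrM mulr_natl.
  rewrite mxtrace_mulC mulmxA repr_mxV // mulmxV ?repr_mx_unit // mul1mx.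
  rewrite /mxtrace (bigD1 m) //= mxE eqxx big1 ?addr0 // => i im.
  by rewrite mxE (negPf im).
(* The factor [d] enters as the trace of the identity: [\tr S] is [d] times the scalar [c]. *)
rewrite -SE Sc mxE -mulnb mulnA natrM -trS Sc mxtrace_scalar.
by rewrite mulr_natl mulr_natr mulrnAC.
Qed.

Section ProjOp.
Variables (R : realType) (n : nat) (gT : finGroupType).
Variable rho : gT -> 'cV[R]_n -> 'cV[R]_n.
Variables (d : nat) (rp : mx_representation R[i] [set: gT]%SET d).
Local Notation V := ('cV[R]_n -> R[i]).
Implicit Types (f u v : V) (F : set V).

Lemma fun_actP a (c : R[i]) u v :
  fun_act rho a (c *: u + v) = c *: fun_act rho a u + fun_act rho a v.
Proof. by []. Qed.

Lemma subspace_sum F (I : finType) (f : I -> V) :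
  subspace F -> (forall i, F (f i)) -> F (\sum_i f i).
Proof.
move=> [F0 FD] Ff; elim/big_rec: _ => // i u _ Fu.
by rewrite -[f i]scale1r; apply: FD.
Qed.

Lemma subspaceZ F (c : R[i]) u : subspace F -> F u -> F (c *: u).
Proof. by move=> [F0 FD] Fu; rewrite -[_ *: _]addr0; apply: FD. Qed.

Lemma proj_op_linear (k l : 'I_d) : linear (proj_op rho rp k l).
Proof.
move=> c u v; rewrite /proj_op; set q := _ / _.
set U := (X in c *: (q *: X)); set W := (X in _ + q *: X).
transitivity (q *: (c *: U + W)); last by rewrite scalerDr !scalerA (mulrC q).
congr (_ *: _); rewrite scaler_sumr -big_split; apply: eq_bigr => a _ /=.
by rewrite fun_actP scalerDr !scalerA (mulrC c).
Qed.

Lemma proj_op_stable F (k l : 'I_d) u :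
  subspace F -> (forall a, fun_act rho a @` F `<=` F) ->
  F u -> F (proj_op rho rp k l u).
Proof.
move=> sF aF Fu; apply: subspaceZ => //; apply: subspace_sum => // a.
by apply: subspaceZ => //; apply: aF; exists u.
Qed.

Lemma koopman_proj_op g (k l : 'I_d) f : equivariant rho g ->
  koopman g (proj_op rho rp k l f) = proj_op rho rp k l (koopman g f).
Proof.
move=> eg; apply/funext => x.
rewrite /koopman /proj_op /comp /= ![(_ *: _) _]/(_ * _); congr (_ * _).
rewrite !fct_sumE; apply: eq_bigr => a _.
by rewrite ![(_ *: _) _]/(_ * _) /fun_act eg.
Qed.

Hypotheses (rho_act : left_action rho) (irr : unitary_irrep rp).

Lemma unitary_reprV a (k l : 'I_d) : rp a^-1%g k l = Num.conj (rp a l k).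
Proof.
have [/(_ a) U _] := irr.
by rewrite repr_mxV ?inE // invmx_unitary // !mxE.
Qed.

Lemma fun_act_comp a b f : fun_act rho a (fun_act rho b f) = fun_act rho (a * b)%g f.
Proof.
have [_ rM] := rho_act.
by apply/funext => x; rewrite /fun_act -rM invMg.
Qed.

(** Collecting the double sum by the product of the two group elements leaves one sum whose
    coefficients are convolutions of conjugated matrix entries. Orthogonality evaluates these, and
    the normalisation [d / #|gT|] makes the surviving constant 1. *)
Lemma proj_op_comp (k l m j : 'I_d) f :
  proj_op rho rp k l (proj_op rho rp m j f) =
  (l == m)%:R *: proj_op rho rp k j f.
Proof.
have [_ irr_rp] := irr.
have G0 : #|gT|%:R != 0 :> R[i] by rewrite pnatr_eq0 -lt0n; apply/card_gt0P; exists 1%g.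
set q : R[i] := d%:R / #|gT|%:R.
have conv c : q * (\sum_a Num.conj (rp a k l) * Num.conj (rp (a^-1 * c)%g m j)) =
    (l == m)%:R * Num.conj (rp c k j).
  (* Multiplicativity splits off the dependence on [c]; unitarity trades conjugates for inverses,
     giving the form required by orthogonality. *)
  have coefE a : Num.conj (rp a k l) * Num.conj (rp (a^-1 * c)%g m j) =
      \sum_i Num.conj (rp c i j) * (rp a^-1%g l k * rp a i m).
    rewrite repr_mxM ?inE // mxE rmorph_sum mulr_sumr; apply: eq_bigr => i _.
    rewrite rmorphM /= !unitary_reprV conjCK.
    by rewrite mulrA mulrC.
  rewrite (eq_bigr _ (fun a _ => coefE a)) exchange_big /= mulr_sumr.
  have orth i : q * (\sum_a Num.conj (rp c i j) * (rp a^-1%g l k * rp a i m)) =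
      Num.conj (rp c i j) * ((k == i) && (l == m))%:R.
    have := mx_irr_coef_orthogonality k l i m irr_rp.
    rewrite cardsT natrM (eq_bigl xpredT) => [E|a]; last by rewrite inE.
    rewrite -mulr_sumr mulrCA; congr (_ * _).
    by rewrite /q mulrAC E mulrAC divff // mul1r.
  rewrite (eq_bigr _ (fun i _ => orth i)) (bigD1 k) //= big1 => [|i ik].
    by rewrite addr0 eqxx mulrC.
  by rewrite eq_sym (negPf ik) mulr0.
rewrite {1 2}/proj_op -/q.
have fun_act_sum a : fun_act rho a
      (q *: \sum_b Num.conj (rp b m j) *: fun_act rho b f) =
    q *: \sum_c Num.conj (rp (a^-1 * c)%g m j) *: fun_act rho c f.
  have -> : fun_act rho a (q *: \sum_b Num.conj (rp b m j) *: fun_act rho b f) =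
      q *: \sum_b Num.conj (rp b m j) *: fun_act rho a (fun_act rho b f).
    by apply/funext => x; rewrite /fun_act ![(_ *: _) _]/(_ * _) !fct_sumE.
  (* The substitution is [c = a * b]. *)
  rewrite [in RHS](reindex_inj (mulgI a)) /=; congr (_ *: _).
  by apply: eq_bigr => b _; rewrite mulKg fun_act_comp.
rewrite (eq_bigr _ (fun a _ => congr1 _ (fun_act_sum a))).
(* One factor [q] stays outside for the resulting operator; the other joins the convolution, as in
   [conv]. *)
transitivity (q *: \sum_c (q * \sum_a Num.conj (rp a k l) *
    Num.conj (rp (a^-1 * c)%g m j)) *: fun_act rho c f).
  congr (_ *: _); under eq_bigr do rewrite scalerA mulrC -scalerA scaler_sumr.
  rewrite -scaler_sumr exchange_big scaler_sumr; apply: eq_bigr => c _.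
  rewrite -scalerA scaler_suml; congr (_ *: _).
  by apply: eq_bigr => a _; rewrite scalerA.
transitivity (q *: ((l == m)%:R *: \sum_c Num.conj (rp c k j) *: fun_act rho c f)).
  congr (_ *: _); rewrite scaler_sumr.
  by apply: eq_bigr => c _; rewrite conv scalerA.
by rewrite /proj_op -/q !scalerA (mulrC q).
Qed.

(** Since [P_ml f = P_mm (P_ml f)], the union over [l] is the image of a single linear operator.
    This makes closure under addition visible. *)
Lemma row_componentE F (m : 'I_d) :
  subspace F -> (forall a, fun_act rho a @` F `<=` F) ->
  row_component rho rp F m = proj_op rho rp m m @` F.
Proof.
move=> sF aF; apply/seteqP; split => [_ [f [l [Ff ->]]]|_ [f Ff <-]]; last by exists f, m.
exists (proj_op rho rp m l f); first exact: proj_op_stable.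
by rewrite proj_op_comp eqxx scale1r.
Qed.

Lemma row_component_subspace F (m : 'I_d) :
  subspace F -> (forall a, fun_act rho a @` F `<=` F) ->
  subspace (row_component rho rp F m).
Proof.
move=> sF aF; rewrite row_componentE //; have [F0 FD] := sF; split.
  (* Linearity at [c = -1], [u = v = 0] yields [P_mm 0 = 0]. *)
  exists 0 => //; have := proj_op_linear m m (-1) 0 0.
  by rewrite !scaleN1r oppr0 add0r addNr.
move=> c _ _ [u Fu <-] [v Fv <-]; exists (c *: u + v); first exact: FD.
exact: proj_op_linear.
Qed.

(** [P_mk P_km = P_mm], which fixes every [P_ml f]. *)
Lemma proj_op_row_componentK F (k m : 'I_d) u :
  row_component rho rp F m u -> proj_op rho rp m k (proj_op rho rp k m u) = u.
Proof.
by move=> [f [l [_ ->]]]; rewrite !(proj_op_comp, eqxx, scale1r).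
Qed.

Lemma proj_op_row_component F (k m : 'I_d) u :
  row_component rho rp F m u -> row_component rho rp F k (proj_op rho rp k m u).
Proof.
by move=> [f [l [Ff ->]]]; rewrite proj_op_comp eqxx scale1r; exists f, l.
Qed.

End ProjOp.

Theorem mainTheorem4 (R : realType) (n : nat) (gT : finGroupType)
    (rho : gT -> 'cV[R]_n -> 'cV[R]_n) (g : 'cV[R]_n -> 'cV[R]_n)
    (F : set ('cV[R]_n -> R[i])) (d : nat)
    (rp : mx_representation R[i] [set: gT]%SET d)
    (rho_act : left_action rho) (g_equiv : equivariant rho g)
    (F_sub : subspace F)
    (F_koopman : koopman g @` F `<=` F)
    (F_act : forall a : gT, fun_act rho a @` F `<=` F)
    (rp_irr : unitary_irrep rp) :
  [/\ (forall m : 'I_d,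
         koopman g @` row_component rho rp F m `<=` row_component rho rp F m),
      (forall (f : 'cV[R]_n -> R[i]) (m l : 'I_d), F f ->
         row_component rho rp F m (koopman g (proj_op rho rp m l f))),
      (forall (f h : 'cV[R]_n -> R[i]) (k m l : 'I_d), F f ->
         koopman g (proj_op rho rp m l f) = h ->
         koopman g (proj_op rho rp k l f) = proj_op rho rp k m h)
    & (forall k m : 'I_d,
         linear_iso_on (row_component rho rp F m) (row_component rho rp F k)
           (proj_op rho rp k m) /\
         (forall u, row_component rho rp F m u ->
            proj_op rho rp k m (koopman g u) =
            koopman g (proj_op rho rp k m u)))].
Proof.
have K_row m : koopman g @` row_component rho rp F m `<=` row_component rho rp F m.
  move=> _ [_ [f [l [Ff ->]]] <-]; exists (koopman g f), l.
  by split; [apply: F_koopman; exists f | apply: koopman_proj_op].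
split => //.
- by move=> f m l Ff; apply: K_row; exists (proj_op rho rp m l f) => //; exists f, l.
- move=> f _ k m l Ff <-.
  (* Both sides reduce to [P_kl] applied to [koopman g f]. *)
  by rewrite !koopman_proj_op // proj_op_comp // eqxx scale1r.
move=> k m; split => [|u _]; last by rewrite koopman_proj_op.
split; [exact: row_component_subspace | exact: row_component_subspace | |].
  by move=> c u v _ _; apply: proj_op_linear.
split.
- by move=> u mu; exact: (proj_op_row_component rho_act rp_irr k mu).
(* Injectivity comes from the left inverse [P_mk]; the same operator supplies preimages for
   surjectivity. *)
- move=> u v /set_mem mu /set_mem mv E.
  rewrite -(proj_op_row_componentK rho_act rp_irr k mu) E.
  exact: (proj_op_row_componentK rho_act rp_irr k mv).
- move=> v kv; exists (proj_op rho rp m k v).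
    exact: (proj_op_row_component rho_act rp_irr m kv).
  exact: (proj_op_row_componentK rho_act rp_irr m kv).
Qed.
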